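(* Let $q\in\mathbb C$ with $0<|q|<1$, $z\in\mathbb C\setminus\{0\}$, $x=\frac12(z+z^{-1})$, $a,b,t,\delta\in\mathbb C$, $\gamma\in\mathbb C\setminus\{0\}$ with $|\gamma|<1$. Assume $|at|<1$, $|bt|<1$ and $\delta,-tz,-tz^{-1}\notin\{q^{-k}:k\in\mathbb N_0\}$. Then the $q^{-1}$-Al-Salam--Chihara polynomials $Q_n(x;a,b|q^{-1})$ satisfy $$\sum_{n=0}^\infty\frac{q^{\binom n2}t^n(\gamma;q)_n}{(q,\delta;q)_n}\,Q_n(x;a,b|q^{-1})=\frac{(\gamma,-tz,-tz^{-1};q)_\infty}{(\delta,-at,-bt;q)_\infty}\;{}_3\phi_2\left(\frac\delta\gamma,\,-at,\,-bt;\ -tz,\,-tz^{-1};\ q,\gamma\right).$$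
   Context: $\mathbb N_0=\{0,1,2,\dots\}$. $(a;q)_n=\prod_{j=0}^{n-1}(1-aq^j)$ for $n\in\mathbb N_0\cup\{\infty\}$, $(a_1,\dots,a_k;q)_n=\prod_i(a_i;q)_n$, and $${}_r\phi_s(a_1,\dots,a_r;b_1,\dots,b_s;q,w)=\sum_{k\ge0}\frac{(a_1,\dots,a_r;q)_k}{(q,b_1,\dots,b_s;q)_k}\left((-1)^kq^{\binom k2}\right)^{1+s-r}w^k .$$ The $q^{-1}$-Al-Salam--Chihara polynomials, for $x=\frac12(z+z^{-1})$ and $a,b\ne0$, are $$Q_n(x;a,b|q^{-1})=q^{-\binom n2}(-b)^n\left(\tfrac1{ab};q\right)_n\;{}_3\phi_1\left(q^{-n},\frac za,\frac1{az};\ \frac1{ab};\ q,\frac{q^na}b\right);$$ they are polynomials in $x,a,b$, and values at exceptional parameters (such as $a=0$ or $b=0$) are understood by continuity. *)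

(* Defs.v *)
From mathcomp Require Import all_boot all_order all_algebra.
From mathcomp Require Import complex.
From mathcomp Require Import all_classical all_reals all_analysis.

Set Implicit Arguments.
Unset Strict Implicit.
Unset Printing Implicit Defensive.

Import Order.TTheory GRing.Theory Num.Theory.
Import numFieldNormedType.Exports.

Local Open Scope classical_set_scope.
Local Open Scope ring_scope.

Section QSeries.
Variable K : numFieldType.
Implicit Types (q a b x z w : K) (s us vs : seq K) (n k : nat).

Definition qpoch a q n : K := \prod_(j < n) (1 - a * q ^+ j).

Definition qpoch_inf a q : K := limn (qpoch a q).

Definition qpochs s q n : K := \prod_(a <- s) qpoch a q n.

Definition qpochs_inf s q : K := \prod_(a <- s) qpoch_inf a q.

(* The exponent 1 + s - r is an integer, negative for 3phi1. *)
Definition qhyper_term us vs q w k : K :=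
  qpochs us q k / qpochs (q :: vs) q k *
  ((-1) ^+ k * q ^+ 'C(k, 2)) ^ (1 + (size vs)%:Z - (size us)%:Z) *
  w ^+ k.

Definition qhyper us vs q w : K := limn (series (qhyper_term us vs q w)).

Definition qinv_asc_formula q n z a b : K :=
  q ^- 'C(n, 2) * (- b) ^+ n * qpoch (a * b)^-1 q n *
  qhyper [:: q ^- n; z / a; (a * z)^-1] [:: (a * b)^-1] q (q ^+ n * a / b).

(* The parameters at which [qinv_asc_formula] involves no division by zero:
   the nonzero terms of the 3phi1 are those with k <= n, and their denominators
   (1/(ab); q)_k all divide (1/(ab); q)_n. *)
Definition qinv_asc_dom q n : set (K * K) :=
  [set p | [/\ p.1 != 0, p.2 != 0 & qpoch (p.1 * p.2)^-1 q n != 0]].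

(* Q_n(x; a, b | q^-1), where x = (z + 1/z) / 2: the limit of the formula at
   (a', b') as (a', b') tends to (a, b) through [qinv_asc_dom q n].  On that
   dense open set the formula is continuous, so this is its own value there and
   the value by continuity at the exceptional (a, b).  Exchanging z and 1/z, the
   two choices for a given x, leaves the formula unchanged. *)
Definition qinv_asc q n x a b : K :=
  get [set l | forall z, z != 0 -> x = (z + z^-1) / 2 ->
    qinv_asc_formula q n z p.1 p.2
      @[p --> within (qinv_asc_dom q n) (nbhs (a, b))] --> l].

End QSeries.

(* Main.v *)
Require Import Defs.
From mathcomp Require Import all_boot all_order all_algebra.
From mathcomp Require Import complex ring.
From mathcomp Require Import all_classical all_reals all_analysis.
Import Order.TTheory GRing.Theory Num.Theory.
Import numFieldNormedType.Exports.
Local Open Scope classical_set_scope.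
Local Open Scope ring_scope.

(** The engine is the family P_n(b, w) = prod_(j < n) (b - w q^j) / (1 - q^(j+1)),
    [qbinom_coef], with the q-binomial theorem ([qbinomialE])
      sum_n P_n(b, w) = (w; q)_oo / (b; q)_oo    for |b| < 1.

    Since (w)_oo / (y)_oo times (y)_oo / (b)_oo is (w)_oo / (b)_oo, the sequences
    P(b, y) and P(y, w) have Cauchy product P(b, w)
    ([cauchy_prod_qbinom_coef], a purely algebraic fact).  Used twice, this turns
    the terminating 3phi1 defining Q_n into
      q^(n choose 2) Q_n(x; a, b | 1/q) / (q; q)_n
        = (-1)^n (P(a, z) # P(b, 1/z))_n       with # the Cauchy product,
    first where the 3phi1 makes sense ([qinv_asc_formulaE]), and then, the right
    side being a polynomial in a and b, everywhere by continuity ([qinv_ascE]).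
    Consequently, for |at|, |bt| < 1,
      sum_n q^(n choose 2) t^n Q_n / (q; q)_n
        = G(t) := (-tz, -t/z; q)_oo / (-at, -bt; q)_oo.

    The quotient (gamma; q)_n / (delta; q)_n is inserted with the q-binomial
    theorem again:
      (gamma)_n / (delta)_n
        = (gamma)_oo / (delta)_oo * (delta q^n)_oo / (gamma q^n)_oo
        = (gamma)_oo / (delta)_oo * sum_k P_k(gamma, delta) q^(n k).
    Exchanging the sums over n and k leaves sum_k P_k(gamma, delta) G(t q^k), and
    G(t q^k) / G(t) = (-at, -bt; q)_k / (-tz, -t/z; q)_k makes this the 3phi2.

    All the series involved have geometrically dominated terms.  The analysis is
    therefore carried out over any field [K] in which such series converge
    ([geom_complete]); the complex numbers enter only through
    [complex_geom_complete]. *)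

Set Implicit Arguments.
Unset Strict Implicit.
Unset Printing Implicit Defensive.

(** * Finite q-identities *)

Section QAlgebra.
Variables (K : numFieldType) (q : K).
Implicit Types (a b w z : K) (k m n : nat).

Lemma qpochS a n : qpoch a q n.+1 = qpoch a q n * (1 - a * q ^+ n).
Proof. by rewrite /qpoch big_ord_recr. Qed.

Lemma qpoch0 a : qpoch a q 0 = 1.
Proof. by rewrite /qpoch big_ord0. Qed.

Lemma qpochD a m n : qpoch a q (m + n) = qpoch a q m * qpoch (a * q ^+ m) q n.
Proof.
rewrite /qpoch big_split_ord; congr (_ * _).
by apply: eq_bigr => j _; rewrite exprD mulrA.
Qed.

Lemma qpoch_neq0 a n : (forall k, a != q ^- k) -> q != 0 -> qpoch a q n != 0.
Proof.
move=> ha q0; apply/prodf_neq0 => j _; rewrite subr_eq0 eq_sym.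
apply: contra (ha j) => /eqP e.
by rewrite -[a](mulfK (expf_neq0 j q0)) e mul1r.
Qed.

(** Reversing the factors 1 - q^(j-n) = - q^(j-n) (1 - q^(n-j)); multiplying by
    (q; q)_(n-k) keeps the identity free of division. *)
Lemma qpoch_qV n k : q != 0 -> (k <= n)%N ->
  qpoch (q ^- n) q k * qpoch q q (n - k) =
  qpoch q q n * ((-1) ^+ k * q ^+ 'C(k, 2)) * (q ^- n) ^+ k.
Proof.
move=> q0; elim: k => [|k IH] kn.
  by rewrite subn0 qpoch0 mul1r bin0n expr0 !mulr1.
have e : (n - k = (n - k.+1).+1)%N by rewrite subnS prednK // subn_gt0.
have e2 : (n = k + (n - k.+1).+1)%N by rewrite -e subnKC // ltnW.
have := IH (ltnW kn).
rewrite e !qpochS binS bin1 exprD (exprS (-1)) (exprS (q ^- n)).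
set m := (n - k.+1)%N in e e2 *.
have -> : 1 - q ^- n * q ^+ k = - (q ^- n * q ^+ k) * (1 - q * q ^+ m).
  rewrite e2 exprD exprS; set x := q ^+ k; set y := q ^+ m.
  have x0 : x != 0 by rewrite expf_neq0.
  have y0 : y != 0 by rewrite expf_neq0.
  by field; rewrite x0 y0 q0.
set x := q ^- n; set y := q ^+ k => IHk.
transitivity (- (x * y) * (qpoch x q k * (qpoch q q m * (1 - q * q ^+ m)))).
  by ring.
by rewrite IHk; ring.
Qed.

(** The quotient b^n (w/b; q)_n / (q; q)_n in a form polynomial in b, where b = 0
    is not exceptional. *)
Definition qbinom_coef b w n : K :=
  \prod_(j < n) ((b - w * q ^+ j) / (1 - q ^+ j.+1)).

Definition cauchy_prod (f g : nat -> K) n : K := \sum_(k < n.+1) f k * g (n - k)%N.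

Lemma exchange_triangle (F : nat -> nat -> K) n :
  \sum_(k < n.+1) \sum_(j < (n - k).+1) F k j =
  \sum_(j < n.+1) \sum_(k < (n - j).+1) F k j.
Proof.
have wid (G : nat -> K) k : (k < n.+1)%N ->
    \sum_(j < (n - k).+1) G j = \sum_(j < n.+1 | (k + j <= n)%N) G j.
  move=> kn; rewrite (big_ord_widen n.+1 G) ?ltnS ?leq_subr //.
  by apply: eq_bigl => j; rewrite ltnS leq_subRL // -ltnS.
under eq_bigr => k _ do rewrite wid //.
rewrite (exchange_big_dep xpredT) //=; apply: eq_bigr => j _.
by rewrite (wid (fun k => F k j)) //; apply: eq_bigl => k; rewrite addnC.
Qed.

Lemma qbinom_coef0 b w : qbinom_coef b w 0 = 1.
Proof. by rewrite /qbinom_coef big_ord0. Qed.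

Lemma qbinom_coefZ c b w n :
  qbinom_coef (c * b) (c * w) n = c ^+ n * qbinom_coef b w n.
Proof.
rewrite /qbinom_coef -[in c ^+ n](card_ord n) -prodr_const -big_split /=.
by apply: eq_bigr => j _; ring.
Qed.

Hypothesis hq : forall n, q ^+ n.+1 != 1.

Let q1 n : 1 - q ^+ n.+1 != 0.
Proof. by rewrite subr_eq0 eq_sym. Qed.

Lemma qpochqq_neq0 n : qpoch q q n != 0.
Proof. by apply/prodf_neq0 => j _; rewrite -exprS. Qed.

(** The coefficient form of (1 - b t) F(t) = (1 - w t) F(q t), where F is the
    generating function in t. *)
Lemma qbinom_coefS b w n :
  (1 - q ^+ n.+1) * qbinom_coef b w n.+1 = (b - w * q ^+ n) * qbinom_coef b w n.
Proof.
rewrite /qbinom_coef big_ord_recr /= mulrCA [_ / _]mulrC mulVKf //.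
by rewrite mulrC.
Qed.

Lemma qbinom_coefE b w n :
  qpoch q q n * qbinom_coef b w n = \prod_(j < n) (b - w * q ^+ j).
Proof.
rewrite /qpoch /qbinom_coef -big_split /=; apply: eq_bigr => j _.
by rewrite -exprS mulrC mulfVK.
Qed.

Lemma qbinom_coef_qpoch b w n : b != 0 ->
  qpoch q q n * qbinom_coef b w n = b ^+ n * qpoch (w / b) q n.
Proof.
move=> b0; rewrite qbinom_coefE /qpoch -[in b ^+ n](card_ord n) -prodr_const.
by rewrite -big_split /=; apply: eq_bigr => j _; field.
Qed.

(** The middle parameter cancels as in (wt/yt)(yt/bt) = wt/bt.  The proof stays
    with coefficients: splitting 1 - q^n = (1 - q^k) + q^k (1 - q^(n-k)) shows that
    the Cauchy product obeys the recurrence [qbinom_coefS], the terms in y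
    cancelling. *)
Lemma cauchy_prod_qbinom_coef b y w n :
  cauchy_prod (qbinom_coef b y) (qbinom_coef y w) n = qbinom_coef b w n.
Proof.
elim: n => [|n IH]; first by rewrite /cauchy_prod big_ord1 !qbinom_coef0 mulr1.
apply: (mulfI (q1 n)); rewrite qbinom_coefS -IH /cauchy_prod.
transitivity (\sum_(k < n.+2) (1 - q ^+ k) * qbinom_coef b y k *
      qbinom_coef y w (n.+1 - k)
   + \sum_(k < n.+2) q ^+ k * qbinom_coef b y k *
      ((1 - q ^+ (n.+1 - k)) * qbinom_coef y w (n.+1 - k))).
  rewrite -big_split mulr_sumr; apply: eq_bigr => k _ /=.
  (* The weight 1 - q^(n+1) is shared between the two factors of each term. *)
  have -> : q ^+ n.+1 = q ^+ k * q ^+ (n.+1 - k).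
    by rewrite -exprD subnKC // -ltnS.
  by ring.
rewrite big_ord_recl expr0 subrr !mul0r add0r.
rewrite [X in _ + X]big_ord_recr /= subnn subrr mul0r mulr0 addr0.
rewrite mulr_sumr -big_split; apply: eq_bigr => k _ /=.
have kn : (k <= n)%N by rewrite -ltnS.
rewrite /bump leq0n add1n subSS qbinom_coefS subSn // qbinom_coefS.
have -> : q ^+ n = q ^+ k * q ^+ (n - k) by rewrite -exprD subnKC.
by ring.
Qed.

(** With second parameter q^k / a the factors of P_m(1/z, q^k/a) are, up to the
    constant 1/(az), the factors number k, ..., k + m - 1 of P(a, z): this is what
    makes b = 1/z a value at which the sum can be evaluated. *)
Lemma qbinom_coef_split a z k m : a != 0 -> z != 0 ->
  qbinom_coef a z k * qbinom_coef z^-1 (q ^+ k / a) m =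
  qbinom_coef a z (k + m) * qpoch q q (k + m) * (a * z)^-1 ^+ m
    / (qpoch q q k * qpoch q q m).
Proof.
move=> a0 z0; apply/(canRL (mulfK _)); first by rewrite mulf_neq0 ?qpochqq_neq0.
transitivity (qpoch q q k * qbinom_coef a z k *
    (qpoch q q m * qbinom_coef z^-1 (q ^+ k / a) m)); first by ring.
rewrite [qbinom_coef a z (k + m) * _]mulrC !qbinom_coefE big_split_ord /=.
rewrite -mulrA; congr (_ * _).
rewrite -[in _ ^+ m](card_ord m) -prodr_const -big_split /=.
by apply: eq_bigr => j _; rewrite exprD; field; rewrite a0 z0.
Qed.

(** The 3phi1 after cancelling (q^-n; q)_k and (1/(ab); q)_k: up to the factor
    (-1)^n q^-(n choose 2) (q; q)_n it is the terminating sum defining Q_n. *)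
Definition asc_sum z a b n : K :=
  \sum_(k < n.+1) qbinom_coef a z k * qpoch (a * z)^-1 q k *
    qbinom_coef b (q ^+ k / a) (n - k).

(** At b = 1/z every term contains P_n(a, z), and what remains is the Cauchy
    product of P(1, 1/(az)) and P(1/(az), 0). *)
Lemma asc_sum_base z a n : a != 0 -> z != 0 ->
  asc_sum z a z^-1 n = qbinom_coef a z n.
Proof.
move=> a0 z0; rewrite /asc_sum.
have key : \sum_(k < n.+1) qpoch (a * z)^-1 q k / qpoch q q k *
     ((a * z)^-1 ^+ (n - k) / qpoch q q (n - k)) = (qpoch q q n)^-1.
  have az0 : (a * z)^-1 != 0 by rewrite invr_eq0 mulf_neq0.
  (* 1 / (q; q)_n is P_n(1, 0). *)
  transitivity (qbinom_coef 1 0 n); last first.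
    apply: (mulfI (qpochqq_neq0 n)); rewrite qbinom_coef_qpoch ?oner_eq0 //.
    by rewrite divr1 expr1n mul1r /qpoch big1 ?divff ?qpochqq_neq0 // => j _;
      rewrite mul0r subr0.
  rewrite -(cauchy_prod_qbinom_coef 1 (a * z)^-1 0); apply: eq_bigr => k _.
  congr (_ * _).
    apply: (mulfI (qpochqq_neq0 k)).
    by rewrite qbinom_coef_qpoch ?oner_eq0 // divr1 expr1n mul1r mulrC
      mulfVK ?qpochqq_neq0.
  apply: (mulfI (qpochqq_neq0 (n - k))).
  rewrite qbinom_coef_qpoch // mul0r mulrC mulfVK ?qpochqq_neq0 //.
  by rewrite [qpoch 0 _ _]big1 ?mulr1 // => j _; rewrite mul0r subr0.
transitivity (qbinom_coef a z n * qpoch q q n * (qpoch q q n)^-1); last first.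
  by rewrite mulfK ?qpochqq_neq0.
rewrite -key mulr_sumr; apply: eq_bigr => k _.
have kn : (k <= n)%N by rewrite -ltnS.
rewrite mulrAC qbinom_coef_split // subnKC // [(qpoch _ _ _ * _)^-1]invfM.
by ring.
Qed.

(** Passing from 1/z to a general b multiplies both sides by P(b, 1/z) in the
    sense of Cauchy products, so the case b = 1/z suffices. *)
Lemma asc_sum_cauchy_prod z a b n : a != 0 -> z != 0 ->
  asc_sum z a b n = cauchy_prod (qbinom_coef a z) (qbinom_coef b z^-1) n.
Proof.
move=> a0 z0; rewrite {1}/asc_sum.
transitivity (\sum_(k < n.+1) \sum_(j < (n - k).+1)
    qbinom_coef b z^-1 j * (qbinom_coef a z k * qpoch (a * z)^-1 q k *
      qbinom_coef z^-1 (q ^+ k / a) (n - k - j))).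
  apply: eq_bigr => k _; rewrite -(cauchy_prod_qbinom_coef b z^-1) mulr_sumr.
  by apply: eq_bigr => j _; ring.
rewrite (exchange_triangle (fun k j => qbinom_coef b z^-1 j *
   (qbinom_coef a z k * qpoch (a * z)^-1 q k *
      qbinom_coef z^-1 (q ^+ k / a) (n - k - j)))).
rewrite /cauchy_prod (reindex_inj rev_ord_inj) /=; apply: eq_bigr => j _.
have jn : (j <= n)%N by rewrite -ltnS.
rewrite subSS subKn // -mulr_sumr mulrC; congr (_ * _).
rewrite -(asc_sum_base _ a0 z0); apply: eq_bigr => k _.
by rewrite subnAC subKn.
Qed.

End QAlgebra.

(** * The q-inverse Al-Salam--Chihara polynomials as Cauchy products *)

Section QAlSalamChihara.
Variables (K : numFieldType) (q : K).
Hypothesis q0 : q != 0.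
Hypothesis hq : forall n, q ^+ n.+1 != 1.
Implicit Types (a b w z : K) (k m n : nat).

Lemma limn_series_finite (u : K ^nat) n :
  (forall k, (n < k)%N -> u k = 0) -> limn (series u) = \sum_(k < n.+1) u k.
Proof.
move=> u0; apply: lim_near_cst => //.
near=> m.
have nm : (n.+1 <= m)%N by near: m; exists n.+1.
rewrite /series /= (big_cat_nat (n := n.+1)) //= [X in _ + X]big_nat_cond.
rewrite [X in _ + X]big1 ?addr0 ?big_mkord // => k /andP[/andP[nk _] _].
exact: u0.
Unshelve. all: by end_near. Qed.

Lemma qpoch_qV_eq0 n k : (n < k)%N -> qpoch (q ^- n) q k = 0.
Proof.
move=> nk; rewrite /qpoch (bigD1 (Ordinal nk)) //= mulVf ?expf_neq0 //.
by rewrite subrr mul0r.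
Qed.

Lemma qinv_asc_formulaE n z a b : z != 0 -> qinv_asc_dom q n (a, b) ->
  qinv_asc_formula q n z a b =
  q ^- 'C(n, 2) * (-1) ^+ n * qpoch q q n *
    cauchy_prod (qbinom_coef q a z) (qbinom_coef q b z^-1) n.
Proof.
move=> z0 [/= a0 b0 ab0]; rewrite -asc_sum_cauchy_prod //.
rewrite /qinv_asc_formula /qhyper.
rewrite (limn_series_finite (n := n)); last first.
  move=> k nk; rewrite /qhyper_term /qpochs !big_cons qpoch_qV_eq0 //.
  by rewrite !mul0r.
rewrite /asc_sum !mulr_sumr; apply: eq_bigr => k _.
have kn : (k <= n)%N by rewrite -ltnS.
rewrite /qhyper_term /qpochs !big_cons !big_nil !mulr1 /=.
(* For a 3phi1 the power of (-1)^k q^(k choose 2) is -1. *)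
have -> : (1 + 1%:Z - 3%:Z) = -1 by [].
rewrite -[in RHS](mulfK (qpochqq_neq0 hq (n - k)) (qbinom_coef _ b _ _)).
rewrite [qbinom_coef _ b _ _ * _]mulrC qbinom_coef_qpoch //.
rewrite -[in RHS](mulfK (qpochqq_neq0 hq k) (qbinom_coef _ a _ _)).
rewrite [qbinom_coef _ a _ _ * _]mulrC qbinom_coef_qpoch //.
have h1 := qpoch_qV q0 kn.
have -> : qpoch (q ^- n) q k =
   qpoch q q n * ((-1) ^+ k * q ^+ 'C(k, 2)) * (q ^- n) ^+ k / qpoch q q (n - k).
  by rewrite -h1 mulfK // qpochqq_neq0.
move: ab0.
have -> : qpoch (a * b)^-1 q n =
   qpoch (a * b)^-1 q k * qpoch (q ^+ k / a / b) q (n - k).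
  rewrite -{1}(subnKC kn) qpochD; congr (_ * qpoch _ _ _).
  by field; rewrite a0 b0.
rewrite mulf_eq0 negb_or => /andP[ab0 _].
rewrite exprN1.
have -> : (- b) ^+ n = (-1) ^+ n * b ^+ k * b ^+ (n - k).
  by rewrite (exprNn b) -[in b ^+ n](subnKC kn) exprD mulrA.
have s0 : (-1) ^+ k * q ^+ 'C(k, 2) != 0 :> K.
  by rewrite mulf_neq0 ?expf_neq0 ?oppr_eq0 ?oner_eq0.
rewrite (exprMn _ (q ^+ n * a)) (exprMn _ (q ^+ n)) !exprVn.
have := expf_neq0 k b0; have := expf_neq0 k (expf_neq0 n q0).
have := qpochqq_neq0 hq k; have := qpochqq_neq0 hq (n - k).
set x1 := qpoch q q k; set x2 := qpoch q q (n - k); set x3 := (_ ^+ n) ^+ k.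
set x4 := b ^+ k; set x5 := (-1) ^+ k * _ in s0 *.
set x6 := qpoch _^-1 q k in ab0 *; set x7 := qpoch _^-1 q k.
move=> n2 n1 n3 n4; field.
by rewrite n1 n2 n3 n4 s0 ab0 expf_neq0.
Qed.

Lemma qbinom_coef_cvg {T : Type} (F : set_system T) {FF : Filter F}
    (f : T -> K) b w n :
  f @ F --> b -> qbinom_coef q (f x) w n @[x --> F] --> qbinom_coef q b w n.
Proof.
move=> fb; elim: n => [|n IH].
  by under eq_fun do rewrite qbinom_coef0; rewrite qbinom_coef0; exact: cvg_cst.
rewrite /qbinom_coef big_ord_recr /=.
under eq_fun do rewrite big_ord_recr /=.
apply: cvgM; first exact: IH.
by apply: cvgM; [apply: cvgB => //|]; apply: cvg_cst.
Qed.

Lemma cauchy_prod_qbinom_coef_cvg {T : Type} (F : set_system T) {FF : Filter F}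
    (f g : T -> K) a b z n : f @ F --> a -> g @ F --> b ->
  cauchy_prod (qbinom_coef q (f x) z) (qbinom_coef q (g x) z^-1) n @[x --> F] -->
  cauchy_prod (qbinom_coef q a z) (qbinom_coef q b z^-1) n.
Proof.
move=> fa gb; rewrite /cauchy_prod; apply: cvg_big => //.
  exact: add_continuous.
by move=> k _; apply: cvgM; apply: qbinom_coef_cvg.
Qed.

(** Along the diagonal (a + e, b + e), the exceptional values of e are roots of a
    single nonzero polynomial, while every neighbourhood of 0 contains more points
    e / 2, e / 3, ... than that polynomial can have roots. *)
Lemma qinv_asc_dom_dense n (p : K * K) : closure (qinv_asc_dom q n) p.
Proof.
case: p => a b B nB.
have cv : (a + e, b + e) @[e --> nbhs (0 : K)] --> (a, b).
  have h c : c + e @[e --> nbhs (0 : K)] --> c.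
    by rewrite -[X in _ --> X]addr0; apply: cvgD; [exact: cvg_cst|exact: cvg_id].
  by have H := cvg_pair (h a) (h b); exact: H.
have /nbhs_ballP[e /= e0 eB] := cv _ nB.
pose quad : {poly K} := ('X + a%:P) * ('X + b%:P).
pose r : {poly K} := quad * \prod_(j < n) (quad - (q ^+ j)%:P).
have quad0 : quad != 0.
  by rewrite mulf_neq0 // -size_poly_gt0 size_XaddC.
have r0 : r != 0.
  rewrite mulf_neq0 //; apply/prodf_neq0 => j _; apply/eqP.
  (* At -a the product vanishes, so each remaining factor takes the value -q^j. *)
  move=> /(congr1 (fun s : {poly K} => s.[- a])); rewrite !hornerE addNr mul0r.
  by move/eqP; rewrite sub0r oppr_eq0 expf_eq0 (negbTE q0) andbF.
pose s := [seq e / m.+2%:R | m <- iota 0 (size r)].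
have us : uniq s.
  rewrite map_inj_in_uniq ?iota_uniq // => i j _ _ /(mulfI (lt0r_neq0 e0)).
  by move/invr_inj/eqP; rewrite eqr_nat => /eqP[].
have : ~~ all (root r) s.
  by apply/negP => /max_poly_roots-/(_ r0 us); rewrite size_map size_iota ltnn.
move=> /allPn[x /mapP[m _ ->]]; set y := e / _ => ry.
have [y1 y2] : quad.[y] != 0 /\ (\prod_(j < n) (quad - (q ^+ j)%:P)).[y] != 0.
  by apply/andP; rewrite -negb_or -mulf_eq0 -hornerM.
exists (a + y, b + y); split; last first.
  apply: eB; rewrite /ball /= sub0r normrN ger0_norm ?divr_ge0 ?ltW //.
  by rewrite ltr_pdivrMr // ltr_pMr // ltr1n.
move: y1 y2; rewrite horner_prod !hornerE ![y + _]addrC mulf_eq0 negb_or.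
move=> /andP[a0 b0] /prodf_neq0 h; split=> //=.
apply/prodf_neq0 => j _; have := h j isT; rewrite !hornerE ![y + _]addrC.
set c := _ * _ => hc.
have c0 : c != 0 by rewrite mulf_neq0.
apply: contra hc => /eqP hc.
by rewrite -[c](mulr1) -[X in c * X](subrK (c^-1 * q ^+ j)) hc add0r mulVKf // subrr.
Qed.

Lemma qinv_asc_formulaV n z a b :
  qinv_asc_formula q n z^-1 a b = qinv_asc_formula q n z a b.
Proof.
have e : qhyper_term [:: q ^- n; z^-1 / a; (a * z^-1)^-1] [:: (a * b)^-1] q =
         qhyper_term [:: q ^- n; z / a; (a * z)^-1] [:: (a * b)^-1] q.
  apply/funext => w; apply/funext => k; rewrite /qhyper_term /qpochs !big_cons.
  congr (_ * _ / _ * _ * _); rewrite mulrCA !invfM invrK.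
  by congr (qpoch _ _ _ * (qpoch _ _ _ * _)); rewrite mulrC.
by rewrite /qinv_asc_formula /qhyper e.
Qed.

(** With [qinv_asc_formulaV], this covers all the choices of z allowed in the
    definition of Q_n. *)
Lemma half_addV_inj z y : z != 0 -> y != 0 ->
  (z + z^-1) / 2 = (y + y^-1) / 2 -> y = z \/ y = z^-1.
Proof.
move=> z0 y0 e.
have /eqP : (y - z) * (y - z^-1) = 0.
  transitivity (y * ((y + y^-1) / 2 - (z + z^-1) / 2) * 2).
    by field; rewrite z0 y0.
  by rewrite -e subrr mulr0 mul0r.
by rewrite mulf_eq0 !subr_eq0 => /orP[]/eqP ->; [left|right].
Qed.

(** The right side is continuous in (a, b) and agrees with the formula on a set
    to which (a, b) is adherent; limits along that set are unique. *)
Lemma qinv_ascE n z x a b : z != 0 -> x = (z + z^-1) / 2 ->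
  qinv_asc q n x a b =
  q ^- 'C(n, 2) * (-1) ^+ n * qpoch q q n *
    cauchy_prod (qbinom_coef q a z) (qbinom_coef q b z^-1) n.
Proof.
move=> z0 xz; set L := RHS.
pose F := within (qinv_asc_dom q n) (nbhs (a, b)).
have PF : ProperFilter F.
  by apply: within_nbhs_proper; apply: qinv_asc_dom_dense.
have cz : qinv_asc_formula q n z p.1 p.2 @[p --> F] --> L.
  have H : q ^- 'C(n, 2) * (-1) ^+ n * qpoch q q n * cauchy_prod
      (qbinom_coef q p.1 z) (qbinom_coef q p.2 z^-1) n @[p --> F] --> L.
    apply: cvgM; first exact: cvg_cst.
    apply: cauchy_prod_qbinom_coef_cvg.
      by apply: cvg_trans (cvg_fst (F := nbhs a) (G := nbhs b));
        apply: cvg_app; exact: cvg_within.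
    by apply: cvg_trans (cvg_snd (F := nbhs a) (G := nbhs b));
      apply: cvg_app; exact: cvg_within.
  apply: cvg_trans H; apply: near_eq_cvg.
  rewrite near_withinE; apply: nearW => -[a' b'] dom /=.
  by rewrite qinv_asc_formulaE.
pose A := [set l : K | forall z, z != 0 -> x = (z + z^-1) / 2 ->
    qinv_asc_formula q n z p.1 p.2 @[p --> F] --> l].
have AL : A L.
  move=> y y0; rewrite xz => /(half_addV_inj z0 y0)[] -> //.
  by under eq_fun do rewrite qinv_asc_formulaV.
have AG : A (get A) by apply: getPex; exists L.
exact: (cvg_unique _ (AG z z0 xz) cz).
Qed.

End QAlSalamChihara.

(** * Geometrically dominated series *)

Definition geom_bounded (K : numFieldType) (f : K ^nat) :=
  exists A r, 0 < r < 1 /\ forall n, `|f n| <= A * r ^+ n.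

(** A form of completeness phrased with the norm valued in K itself, so that the
    dominating series lives in the same field. *)
Definition geom_complete (K : numFieldType) :=
  forall f : K ^nat, geom_bounded f -> cvgn (series f).

Lemma geom_bound_ge0 (K : numFieldType) (f : K ^nat) A r :
  (forall n, `|f n| <= A * r ^+ n) -> 0 <= A.
Proof. by move=> /(_ 0%N); rewrite mulr1; apply: le_trans. Qed.

Section ComplexComplete.
Variable R : realType.
Local Open Scope complex_scope.

Lemma ge0_complexE (r : R[i]) : 0 <= r ->
  r = (complex.Re r)%:C /\ 0 <= complex.Re r.
Proof. by case: r => x y; rewrite lecE /= => /andP[/eqP-> ?]. Qed.

Lemma normc_le_ReIm (u : R[i]) :
  `|u| <= `|complex.Re u|%:C + `|complex.Im u|%:C.
Proof.
case: u => a b; rewrite normc_def /= -rmorphD lecR.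
rewrite -[leRHS]ger0_norm ?addr_ge0 // -sqrtr_sqr ler_wsqrtr //.
by rewrite sqrrD !real_normK ?num_real // addrAC lerDl mulrn_wge0 ?mulr_ge0.
Qed.

Lemma normc_ge_Im (u : R[i]) : `|complex.Im u|%:C <= `|u|.
Proof.
by case: u => a b; rewrite normc_def /= lecR -sqrtr_sqr ler_wsqrtr // lerDr sqr_ge0.
Qed.

(** The real and imaginary parts are real series dominated by the same geometric
    series. *)
Lemma complex_geom_complete : geom_complete (R[i] : numFieldType).
Proof.
move=> f [A [r [/andP[r0 r1] fA]]].
have A0 := geom_bound_ge0 fA.
have [eA A0'] := ge0_complexE A0; have [er r0'] := ge0_complexE (ltW r0).
have abs1 : `|complex.Re r| < 1 by rewrite ger0_norm // -(ltcR _ (1 : R)) -er.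
have part (g : R ^nat) : (forall n, (`|g n|)%:C <= `|f n|) -> cvgn (series g).
  move=> gf; apply: normed_cvg.
  apply: (@series_le_cvg _ _ (geometric (complex.Re A) (complex.Re r))) => //.
  - by move=> n /=.
  - by move=> n; rewrite /= mulr_ge0 // exprn_ge0.
  - move=> n; rewrite -lecR /=; apply: le_trans (gf n) (le_trans (fA n) _).
    by rewrite {1}eA {1}er -rmorphXn -rmorphM.
  - exact: is_cvg_geometric_series.
have cRe : cvgn (series (fun n => complex.Re (f n))).
  by apply: part => n; apply: normc_ge_Re.
have cIm : cvgn (series (fun n => complex.Im (f n))).
  by apply: part => n; apply: normc_ge_Im.
set x := limn _ in cRe; set y := limn _ in cIm.
apply/cvg_ex; exists (x +i* y : (R[i] : numFieldType)).
apply/cvgrPdist_lt => e e0; have [ee _] := ge0_complexE (ltW e0).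
have e2 : 0 < complex.Re e / 2 by rewrite divr_gt0 // -(ltcR (0 : R)) -ee.
move/cvgrPdist_lt/(_ _ e2) : cRe; move/cvgrPdist_lt/(_ _ e2) : cIm.
apply: filterS2 => n h1 h2.
apply: le_lt_trans (normc_le_ReIm _) _.
have sRe : complex.Re (series f n) = series (fun n => complex.Re (f n)) n.
  by rewrite /series /=; apply: (big_morph (@complex.Re R)) => // -[? ?] [? ?].
have sIm : complex.Im (series f n) = series (fun n => complex.Im (f n)) n.
  by rewrite /series /=; apply: (big_morph (@complex.Im R)) => // -[? ?] [? ?].
rewrite -rmorphD ee ltcR.
have -> : complex.Re (x +i* y - series f n) = x - complex.Re (series f n).
  by case: (series f n).
have -> : complex.Im (x +i* y - series f n) = y - complex.Im (series f n).
  by case: (series f n).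
rewrite sRe sIm [X in _ < X]splitr; exact: ltrD.
Qed.

End ComplexComplete.

Section GeometricSeries.
Variable K : numFieldType.
Hypothesis cK : geom_complete K.
Implicit Types (f g u : K ^nat) (r s A B l : K).

(** The terms of the convergent series of the r^n tend to 0; an arbitrary
    ordered field would not allow this conclusion. *)
Lemma cvg_expr0 r : 0 < r < 1 -> r ^+ n @[n --> \oo] --> (0 : K).
Proof.
move=> /[dup] r01 /andP[r0 _]; apply: cvg_series_cvg_0; apply: cK.
by exists 1, r; split=> // n; rewrite mul1r normrX gtr0_norm.
Qed.

(** Explicit geometric error bounds are how limits are identified below. *)
Lemma squeeze_geom f l A r : 0 < r < 1 -> (forall n, `|l - f n| <= A * r ^+ n) ->
  f @ \oo --> l.
Proof.
move=> r01 fA; have c0 : A * r ^+ n @[n --> \oo] --> (0 : K).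
  by rewrite -(mulr0 A); apply: cvgMr (cvg_expr0 r01); exact: cvg_cst.
apply/cvgrPdist_lt => e e0; move/cvgrPdist_lt/(_ _ e0): c0.
apply: filterS => n; rewrite sub0r normrN; apply: le_lt_trans.
by apply: le_trans (fA n) (real_ler_norm _); rewrite ger0_real // (le_trans _ (fA n)).
Qed.

Lemma normr_limn_le f l B : f @ \oo --> l -> (forall n, `|f n| <= B) -> `|l| <= B.
Proof.
move=> fl fB; have B0 : 0 <= B := le_trans (normr_ge0 _) (fB 0).
rewrite real_leNgt ?ger0_real //; apply/negP => Bl.
have := Bl; rewrite -subr_gt0 => e0.
have /cvgrPdist_lt/(_ _ e0)[n _ /(_ n (leqnn n))] /= := fl.
suff h : `|l| - B <= `|l - f n| by move=> /(le_lt_trans h); rewrite ltxx.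
rewrite lerBlDr -{1}(subrK (f n) l); apply: le_trans (ler_normD _ _) _.
by rewrite lerD2l.
Qed.

Lemma sum_geom_le f A r m n : 0 < r < 1 -> (forall n, `|f n| <= A * r ^+ n) ->
  `|\sum_(m <= k < n) f k| <= A * r ^+ m / (1 - r).
Proof.
move=> /andP[r0 r1] fA; apply: le_trans (ler_norm_sum _ _ _) _.
have A0 := geom_bound_ge0 fA.
apply: (@le_trans _ _ (\sum_(m <= k < n) A * r ^+ k)).
  by apply: ler_sum => k _.
rewrite -mulr_sumr -mulrA; apply: ler_wpM2l => //.
have [nm|mn] := leqP n m.
  by rewrite big_geq // mulr_ge0 ?exprn_ge0 ?invr_ge0 ?subr_ge0 // ltW.
rewrite -{1}[m]add0n big_addn.
under eq_bigr => i _ do rewrite addnC exprD.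
rewrite -mulr_sumr ler_wpM2l ?exprn_ge0 ?(ltW r0) //.
rewrite -[leRHS]div1r ler_pdivlMr ?subr_gt0 // mulrC big_mkord.
by rewrite -opprB mulNr -subrX1 opprB lerBlDr lerDl exprn_ge0 // ltW.
Qed.

Lemma series_tail_le f A r n : 0 < r < 1 -> (forall n, `|f n| <= A * r ^+ n) ->
  `|limn (series f) - series f n| <= A * r ^+ n / (1 - r).
Proof.
move=> r01 fA; have cf : cvgn (series f) by apply: cK; exists A, r.
have : series f (m + n)%N - series f n @[m --> \oo] --> limn (series f) - series f n.
  by apply: cvgB; [rewrite cvg_shiftn|exact: cvg_cst].
move/normr_limn_le; apply=> m.
rewrite sub_series_geq ?leq_addl //; exact: sum_geom_le.
Qed.

Lemma limn_series_le f A r : 0 < r < 1 -> (forall n, `|f n| <= A * r ^+ n) ->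
  `|limn (series f)| <= A / (1 - r).
Proof.
move=> r01 fA; have := series_tail_le 0 r01 fA.
by rewrite /series /= big_geq // subr0 mulr1.
Qed.

(** Ratio test: any r strictly between |l| and 1 bounds all but finitely many
    ratios, and the constant absorbs the first terms. *)
Lemma geom_bounded_ratio f (c : K ^nat) l :
  (forall n, f n.+1 = c n * f n) -> c @ \oo --> l -> `|l| < 1 -> geom_bounded f.
Proof.
move=> fc cl l1; pose r : K := (`|l| + 1) / 2.
have lr : `|l| < r by rewrite /r midf_lt.
have r1 : r < 1 by rewrite /r midf_lt.
have r0 : 0 < r by apply: le_lt_trans lr.
have e0 : 0 < r - `|l| by rewrite subr_gt0.
have /cvgrPdist_lt/(_ _ e0)[N _ cN] := cl.
have cr n : (N <= n)%N -> `|c n| <= r.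
  move=> /cN /= h; rewrite -(subrK l (c n)); apply: le_trans (ler_normD _ _) _.
  by rewrite -lerBrDr distrC ltW.
(* A sum, rather than a maximum, of the finitely many quotients bounds each one. *)
pose A := \sum_(k < N.+1) `|f k| / r ^+ k.
have term k : 0 <= `|f k| / r ^+ k by rewrite divr_ge0 // exprn_ge0 // ltW.
have A0 n : (n <= N)%N -> `|f n| <= A * r ^+ n.
  move=> nN; rewrite -ler_pdivrMr ?exprn_gt0 // /A.
  rewrite (bigD1 (Ordinal (nN : (n < N.+1)%N))) //= lerDl.
  by apply: sumr_ge0 => k _.
exists A, r; split; first by rewrite r0.
elim=> [|n IH]; first exact: A0.
have [nN|Nn] := leqP n.+1 N; first exact: A0.
rewrite fc normrM exprS mulrCA; apply: ler_pM => //; exact: cr.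
Qed.

(* Fubini *)
(** The parts of the columns beyond row N add up to at most A r^N / (1 - r)^2, by
    two geometric summations. *)
Lemma fubini_geom (u : nat -> nat -> K) A r : 0 < r < 1 ->
  (forall n k, `|u n k| <= A * r ^+ n * r ^+ k) ->
  series (fun n => limn (series (u n))) @ \oo -->
  limn (series (fun k => limn (series (fun n => u n k)))).
Proof.
move=> /[dup] r01 /andP[r0 r1] uA.
have uA' n k : `|u n k| <= A * r ^+ k * r ^+ n by rewrite mulrAC.
have cr n : cvgn (series (u n)) by apply: cK; exists (A * r ^+ n), r.
pose L k := limn (series (fun n => u n k)).
have Lb k : `|L k| <= A / (1 - r) * r ^+ k.
  by rewrite mulrAC; apply: (limn_series_le r01) => n; apply: uA'.
have cL : cvgn (series L) by apply: cK; exists (A / (1 - r)), r.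
apply: (squeeze_geom (A := A / (1 - r) / (1 - r)) r01) => N.
(* The first N rows are the limit of finite rectangles, summed by columns here. *)
have rows : \sum_(0 <= k < M) \sum_(0 <= n < N) u n k @[M --> \oo] -->
    series (fun n => limn (series (u n))) N.
  rewrite /series /= big_mkord.
  under eq_fun do rewrite exchange_big big_mkord.
  apply: cvg_big => [|n _]; [exact: add_continuous|exact: cr].
have : series L M - \sum_(0 <= k < M) \sum_(0 <= n < N) u n k @[M --> \oo] -->
    limn (series L) - series (fun n => limn (series (u n))) N.
  exact: cvgB.
move/normr_limn_le; apply => M.
rewrite /series /= -sumrB.
have : forall k, `|L k - \sum_(0 <= n < N) u n k| <= A * r ^+ N / (1 - r) * r ^+ k.
  move=> k; rewrite mulrAC [A * _ * _]mulrAC.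
  by apply: (series_tail_le (f := fun n => u n k) N r01) => n; apply: uA'.
move/(sum_geom_le (f := fun k => L k - \sum_(0 <= n < N) u n k) 0 M r01).
by rewrite expr0 mulr1 ![A * _ ^+ _ / _]mulrAC [A / _ * _ / _]mulrAC.
Qed.

End GeometricSeries.

Section CauchyProduct.
Variable K : numFieldType.
Hypothesis cK : geom_complete K.
Implicit Types (f g u : K ^nat) (r s A B l c : K).

Lemma seriesMl c f n : series (fun k => c * f k) n = c * series f n.
Proof. by rewrite /series /= mulr_sumr. Qed.

Lemma limn_seriesMl c f : geom_bounded f ->
  limn (series (fun k => c * f k)) = c * limn (series f).
Proof.
move=> bf; rewrite (_ : series _ = fun n => c * series f n).
  by apply: cvg_lim => //; apply: cvgMr; exact: cK.
by apply/funext => n; rewrite seriesMl.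
Qed.

(** A common ratio of the form s^2.  One factor s^n then pays for the n + 1 terms
    of a Cauchy product, or for the second index of a double series. *)
Lemma geom_bounded_common f g : geom_bounded f -> geom_bounded g ->
  exists A s, [/\ 0 < s < 1, 0 <= A,
    forall n, `|f n| <= A * s ^+ n * s ^+ n &
    forall n, `|g n| <= A * s ^+ n * s ^+ n].
Proof.
move=> [A [r [/andP[r0 r1] fA]]] [B [s [/andP[s0 s1] gB]]].
have A0 := geom_bound_ge0 fA.
have B0 := geom_bound_ge0 gB.
(* p = 1 - (1 - r)(1 - s) dominates r and s; m is its midpoint with 1, and
   p <= m^2 by the arithmetic-geometric inequality. *)
pose p := r + s * (1 - r); pose m := (p + 1) / 2.
have rp : r <= p by rewrite lerDl; apply: mulr_ge0; rewrite ?subr_ge0 ltW.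
have sp : s <= p.
  have -> : p = s + r * (1 - s) by rewrite /p; ring.
  by rewrite lerDl; apply: mulr_ge0; rewrite ?subr_ge0 ltW.
have p1 : p < 1.
  have -> : p = 1 - (1 - r) * (1 - s) by rewrite /p; ring.
  by rewrite gtrDl oppr_lt0; apply: mulr_gt0; rewrite subr_gt0.
have p0 : 0 < p := lt_le_trans r0 rp.
have pm : p <= m * m.
  have -> : m * m = p + ((1 - p) / 2) * ((1 - p) / 2) by rewrite /m; field.
  by rewrite lerDl; apply: mulr_ge0; rewrite divr_ge0 // subr_ge0 ltW.
have bound (h : K ^nat) D x : 0 <= D -> D <= A + B -> 0 < x -> x <= p ->
    (forall n, `|h n| <= D * x ^+ n) ->
    forall n, `|h n| <= (A + B) * m ^+ n * m ^+ n.
  move=> D0 DAB x0 xp hD n; apply: le_trans (hD n) _.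
  rewrite -mulrA -exprMn; apply: ler_pM => //; first by rewrite exprn_ge0 ?ltW.
  by apply: lerXn2r; rewrite ?nnegrE ?(ltW x0) ?(le_trans xp pm) // (le_trans (ltW p0) pm).
exists (A + B), m; split.
- by have [h1 h2] := midf_lt p1; rewrite /m h2 (lt_trans p0 h1).
- exact: addr_ge0.
- by apply: (bound f A r) => //; rewrite lerDl.
- by apply: (bound g B s) => //; rewrite lerDr.
Qed.

Lemma cauchy_term_le f g A s n k : 0 < s < 1 -> 0 <= A ->
  (forall n, `|f n| <= A * s ^+ n * s ^+ n) ->
  (forall n, `|g n| <= A * s ^+ n * s ^+ n) ->
  (k <= n)%N -> `|f k * g (n - k)%N| <= A * A * s ^+ n * s ^+ k.
Proof.
move=> /andP[s0 s1] A0 fA gA kn.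
rewrite normrM; apply: le_trans (ler_pM _ _ (fA _) (gA _)) _ => //.
have -> : A * s ^+ k * s ^+ k * (A * s ^+ (n - k) * s ^+ (n - k)) =
    A * A * (s ^+ k * s ^+ (n - k)) * (s ^+ k * s ^+ (n - k)) by ring.
rewrite -exprD subnKC // ler_wpM2l ?mulr_ge0 ?exprn_ge0 ?(ltW s0) //.
by rewrite ler_wiXn2l // ltW.
Qed.

Lemma geom_bounded_cauchy_prod f g : geom_bounded f -> geom_bounded g ->
  geom_bounded (cauchy_prod f g).
Proof.
move=> bf bg; have [A [s [s01 A0 fA gA]]] := geom_bounded_common bf bg.
have /andP[s0 s1] := s01.
exists (A * A / (1 - s)), s; split=> // n.
apply: le_trans (ler_norm_sum _ _ _) _.
apply: (@le_trans _ _ (\sum_(k < n.+1) A * A * s ^+ n * s ^+ k)).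
  by apply: ler_sum => k _; rewrite cauchy_term_le // -ltnS.
rewrite -mulr_sumr [leRHS]mulrAC; apply: ler_wpM2l.
  by rewrite !mulr_ge0 ?exprn_ge0 ?(ltW s0).
have := sum_geom_le (f := fun k => s ^+ k) (A := 1) 0 n.+1 s01.
rewrite big_mkord => h.
rewrite -[X in X <= _]ger0_norm ?sumr_ge0 // => [|k _]; last first.
  by rewrite exprn_ge0 ?ltW.
by apply: le_trans (h _) _ => [k|]; rewrite ?mul1r // normrX gtr0_norm.
Qed.

(** A double series supported on k <= n: its rows sum to the Cauchy product, its
    columns are multiples of shifted copies of the series of g. *)
Lemma limn_series_cauchy_prod f g : geom_bounded f -> geom_bounded g ->
  limn (series (cauchy_prod f g)) = limn (series f) * limn (series g).
Proof.
move=> bf bg; have [A [s [s01 A0 fA gA]]] := geom_bounded_common bf bg.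
have /andP[s0 s1] := s01.
pose v n k := if (k <= n)%N then f k * g (n - k)%N else 0.
have vA n k : `|v n k| <= A * A * s ^+ n * s ^+ k.
  rewrite /v; case: ifP => [kn|_]; last first.
    by rewrite normr0 !mulr_ge0 ?exprn_ge0 ?(ltW s0).
  exact: cauchy_term_le.
have rows : (fun n => limn (series (v n))) = cauchy_prod f g.
  apply/funext => n; rewrite (limn_series_finite (n := n)).
    by apply: eq_bigr => k _; rewrite /v -ltnS ltn_ord.
  by move=> k nk; rewrite /v leqNgt nk.
have cols k : limn (series (fun n => v n k)) = limn (series g) * f k.
  apply: cvg_lim => //.
  rewrite -(cvg_shiftn k).
  have -> : (fun n => series (fun n => v n k) (n + k)%N) =
            (fun n => series g n * f k).
    apply/funext => n; rewrite /series /= (big_cat_nat (n := k)) ?leq_addl //=.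
    rewrite big_nat_cond big1 ?add0r; last first.
      by move=> i /andP[/andP[_ ik] _]; rewrite /v leqNgt ik.
    rewrite -{1}[k]add0n big_addn addnK mulr_suml; apply: eq_bigr => i _.
    by rewrite /v leq_addl addnK mulrC.
  by apply: cvgMl; exact: cK.
have := fubini_geom cK s01 vA; rewrite rows => /cvg_lim -> //.
under eq_fun do rewrite cols.
by rewrite limn_seriesMl // mulrC.
Qed.

End CauchyProduct.

(** * The q-binomial theorem and the generating function *)

Section QSeriesTheory.
Variable K : numFieldType.
Hypothesis cK : geom_complete K.
Variable q : K.
Hypotheses (hq0 : 0 < `|q|) (hq1 : `|q| < 1).
Implicit Types (a b w z c : K) (k m n : nat).

Let q0 : q != 0. Proof. by rewrite -normr_gt0. Qed.

Lemma norm_lt1_expr_neq1 n : q ^+ n.+1 != 1.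
Proof.
apply/eqP => /(congr1 (fun c => `|c|)); rewrite normrX normr1 => /eqP.
by rewrite lt_eqF // exprn_ilt1.
Qed.
Let hq := norm_lt1_expr_neq1.

Lemma cvg_exprq : q ^+ n @[n --> \oo] --> (0 : K).
Proof.
apply: cvg_series_cvg_0; apply: cK; exists 1, `|q|; split; first exact/andP.
by move=> n; rewrite mul1r normrX.
Qed.

(** The increments -a q^n (a; q)_n have ratio q (1 - a q^n), which tends to q. *)
Lemma cvg_qpoch a : qpoch a q @ \oo --> qpoch_inf a q.
Proof.
pose u n := - a * q ^+ n * qpoch a q n.
have bu : geom_bounded u.
  apply: (geom_bounded_ratio (c := fun n => q * (1 - a * q ^+ n)) (l := q)) => //.
    by move=> n; rewrite /u qpochS exprS; ring.
  have : q * (1 - a * q ^+ n) @[n --> \oo] --> q * (1 - a * 0).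
    apply: cvgMr; apply: cvgB; first exact: cvg_cst.
    by apply: cvgMr; exact: cvg_exprq.
  by rewrite mulr0 subr0 mulr1.
have e : qpoch a q = (fun n => 1 + series u n).
  apply/funext => n; rewrite /series /=; elim: n => [|n IH].
    by rewrite qpoch0 big_geq // addr0.
  by rewrite qpochS big_nat_recr //= addrA -IH /u; ring.
have : cvgn (qpoch a q).
  by rewrite e; apply: is_cvgD; [exact: is_cvg_cst|exact: cK].
by [].
Qed.

Lemma qpoch_infD a m : qpoch_inf a q = qpoch a q m * qpoch_inf (a * q ^+ m) q.
Proof.
apply: cvg_lim => //; rewrite -(cvg_shiftn m).
under eq_fun do rewrite addnC qpochD.
by apply: cvgMr; exact: cvg_qpoch.
Qed.

Lemma geom_bounded_qbinom_coef b w : `|b| < 1 -> geom_bounded (qbinom_coef q b w).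
Proof.
move=> b1.
apply: (geom_bounded_ratio
  (c := fun n => (b - w * q ^+ n) / (1 - q ^+ n.+1)) (l := b)) => // [n|].
  have h : 1 - q ^+ n.+1 != 0 by rewrite subr_eq0 eq_sym.
  by apply: (mulfI h); rewrite qbinom_coefS // mulrA [_ * (_ / _)]mulrC mulfVK.
have : (b - w * q ^+ n) / (1 - q ^+ n.+1) @[n --> \oo] -->
    (b - w * 0) / (1 - 0).
  apply: cvgM.
    by apply: cvgB; [exact: cvg_cst|apply: cvgMr; exact: cvg_exprq].
  apply: cvgV; first by rewrite subr0 oner_eq0.
  apply: cvgB; first exact: cvg_cst.
  by rewrite (cvg_shiftS (fun n => q ^+ n)); exact: cvg_exprq.
by rewrite mulr0 !subr0 divr1.
Qed.

Let S b w := limn (series (qbinom_coef q b w)).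

Lemma norm_exprqM_lt1 b m : `|b| < 1 -> `|q ^+ m * b| < 1.
Proof.
move=> b1; rewrite normrM normrX; apply: le_lt_trans b1.
by rewrite ler_piMl // exprn_ile1 // ltW.
Qed.

(** Summing [qbinom_coefS] over n, where P_n(qb, qw) = q^n P_n(b, w). *)
Lemma qbinom_series_shift b w : `|b| < 1 ->
  (1 - b) * S b w = (1 - w) * S (q * b) (q * w).
Proof.
move=> b1; have bP := geom_bounded_qbinom_coef w b1.
have b1' : `|q * b| < 1 by rewrite -[q]expr1 norm_exprqM_lt1.
have bQ := geom_bounded_qbinom_coef (q * w) b1'.
pose L n := series (qbinom_coef q b w) n.+1 -
  series (qbinom_coef q (q * b) (q * w)) n.+1.
(* L n is the partial sum of (1 - q^k) P_k(b, w) over k <= n; the recurrence gives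
   its second expression. *)
have L1 : L @ \oo --> S b w - S (q * b) (q * w).
  by apply: cvgB; rewrite (cvg_shiftS (series _)); exact: cK.
have L2 : L @ \oo --> b * S b w - w * S (q * b) (q * w).
  have -> : L = (fun n => b * series (qbinom_coef q b w) n -
                          w * series (qbinom_coef q (q * b) (q * w)) n).
    apply/funext => n; rewrite /L /series /= !mulr_sumr -!sumrB big_nat_recl //.
    rewrite !qbinom_coef0 subrr add0r; apply: eq_bigr => k _.
    rewrite !qbinom_coefZ -[X in X - _]mul1r -mulrBl qbinom_coefS //.
    by ring.
  by apply: cvgB; apply: cvgMr; exact: cK.
have := cvg_unique _ L1 L2 => /(_ (@norm_hausdorff _ _)) e.
apply/eqP; rewrite -subr_eq0; apply/eqP.
transitivity ((S b w - S (q * b) (q * w)) - (b * S b w - w * S (q * b) (q * w))).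
  by ring.
by rewrite e subrr.
Qed.

Lemma qbinom_series_shiftn b w m : `|b| < 1 ->
  qpoch b q m * S b w = qpoch w q m * S (q ^+ m * b) (q ^+ m * w).
Proof.
move=> b1; elim: m => [|m IH]; first by rewrite !qpoch0 expr0 !mul1r.
rewrite !qpochS mulrAC IH -!mulrA; congr (_ * _).
rewrite mulrC [b * _]mulrC [w * _]mulrC qbinom_series_shift ?norm_exprqM_lt1 //.
by rewrite !mulrA -!exprS.
Qed.

(** After its first term 1, S(q^m b, q^m w) is dominated by a geometric series of
    ratio |q|^m; the shifted index keeps this ratio below 1. *)
Lemma cvg_qbinom_series1 b w : `|b| < 1 ->
  S (q ^+ m.+1 * b) (q ^+ m.+1 * w) @[m --> \oo] --> (1 : K).
Proof.
move=> b1; have [A [r [/andP[r0 r1] PA]]] := geom_bounded_qbinom_coef w b1.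
have A0 := geom_bound_ge0 PA.
have q01 : 0 < `|q| < 1 by apply/andP.
apply: (squeeze_geom cK (A := A * `|q| / (1 - `|q|)) q01) => m.
have qm : 0 < `|q| ^+ m.+1 < 1 by rewrite exprn_gt0 //= exprn_ilt1.
have := series_tail_le (f := qbinom_coef q (q ^+ m.+1 * b) (q ^+ m.+1 * w))
  (A := A) cK 1 qm.
have -> : series (qbinom_coef q (q ^+ m.+1 * b) (q ^+ m.+1 * w)) 1%N = 1.
  by rewrite /series /= big_nat1 qbinom_coef0.
rewrite distrC => /(_ _)/le_trans; apply.
  move=> n; rewrite qbinom_coefZ normrM !normrX mulrC ler_pM ?exprn_ge0 //.
  apply: le_trans (PA n) _; rewrite ler_piMr // exprn_ile1 // ltW //.
rewrite expr1 exprS mulrA [leRHS]mulrAC.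
apply: ler_wpM2l; first by rewrite !mulr_ge0 ?exprn_ge0.
rewrite lef_pV2 ?posrE ?subr_gt0 //; last by case/andP: qm; rewrite exprS.
by rewrite lerD2l lerN2 ler_piMr // exprn_ile1 // ltW.
Qed.

(** Iterating the shift gives (b)_m S(b, w) = (w)_m S(q^m b, q^m w), and the last
    factor tends to 1. *)
Lemma qbinomial b w : `|b| < 1 -> qpoch_inf b q * S b w = qpoch_inf w q.
Proof.
move=> b1; have c1 : qpoch b q m.+1 * S b w @[m --> \oo] --> qpoch_inf b q * S b w.
  by apply: cvgMl; rewrite (cvg_shiftS (qpoch _ q)); exact: cvg_qpoch.
have c2 : qpoch b q m.+1 * S b w @[m --> \oo] --> qpoch_inf w q.
  under eq_fun do rewrite qbinom_series_shiftn //.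
  rewrite -(mulr1 (qpoch_inf w q)).
  apply: cvgM; last exact: cvg_qbinom_series1.
  by rewrite (cvg_shiftS (qpoch _ q)); exact: cvg_qpoch.
exact: (cvg_unique (@norm_hausdorff _ _) c1 c2).
Qed.

(** By the q-binomial theorem with w = 0 the infinite product has an inverse. *)
Lemma qpoch_inf_neq0_small b : `|b| < 1 -> qpoch_inf b q != 0.
Proof.
move=> b1; have := qbinomial 0 b1.
have -> : qpoch_inf 0 q = 1 :> K.
  apply: cvg_lim => //; have -> : qpoch 0 q = fun=> 1; last exact: cvg_cst.
  by apply/funext => n; rewrite /qpoch big1 // => j _; rewrite mul0r subr0.
move=> e; apply/eqP => b0; move: e; rewrite b0 mul0r => /eqP.
by rewrite eq_sym oner_eq0.
Qed.

Lemma qpoch_inf_neq0 a : (forall k, a != q ^- k) -> qpoch_inf a q != 0.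
Proof.
move=> ha.
have : a * q ^+ n @[n --> \oo] --> (0 : K).
  by rewrite -(mulr0 a); apply: cvgMr; exact: cvg_exprq.
move/cvgrPdist_lt/(_ _ ltr01) => [N _ /(_ N (leqnn N))] /=.
rewrite sub0r normrN => aN.
by rewrite (qpoch_infD a N) mulf_neq0 ?qpoch_neq0 // qpoch_inf_neq0_small.
Qed.

Lemma qbinomialE b w : `|b| < 1 ->
  limn (series (qbinom_coef q b w)) = qpoch_inf w q / qpoch_inf b q.
Proof.
by move=> b1; rewrite -(qbinomial w b1) mulrC mulKf // qpoch_inf_neq0_small.
Qed.

Lemma cauchy_prod_qbinom_coefZ c a z b w n :
  cauchy_prod (qbinom_coef q (c * a) (c * z)) (qbinom_coef q (c * b) (c * w)) n =
  c ^+ n * cauchy_prod (qbinom_coef q a z) (qbinom_coef q b w) n.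
Proof.
rewrite /cauchy_prod mulr_sumr; apply: eq_bigr => k _.
rewrite !qbinom_coefZ -[in c ^+ n](subnKC (_ : k <= n)%N) ?exprD -1?ltnS //.
by ring.
Qed.

Lemma asc_genfun a z b w : `|a| < 1 -> `|b| < 1 ->
  limn (series (cauchy_prod (qbinom_coef q a z) (qbinom_coef q b w))) =
  (qpoch_inf z q * qpoch_inf w q) / (qpoch_inf a q * qpoch_inf b q).
Proof.
move=> a1 b1; rewrite limn_series_cauchy_prod //;
  try exact: geom_bounded_qbinom_coef.
by rewrite !qbinomialE // invfM mulrACA.
Qed.

(** The theorem over any field in which geometrically dominated series converge. *)
Lemma qinv_asc_genfun z x a b t delta gamma
    (hz : z != 0) (hx : x = (z + z^-1) / 2)
    (hgamma0 : gamma != 0) (hgamma1 : `|gamma| < 1)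
    (hat : `|a * t| < 1) (hbt : `|b * t| < 1)
    (hdelta : forall k : nat, delta != q ^- k)
    (htz : forall k : nat, - t * z != q ^- k)
    (htzV : forall k : nat, - t * z^-1 != q ^- k) :
  series (fun n : nat =>
      q ^+ 'C(n, 2) * t ^+ n * qpoch gamma q n / qpochs [:: q; delta] q n *
      qinv_asc q n x a b) @ \oo -->
  qpochs_inf [:: gamma; - t * z; - t * z^-1] q /
  qpochs_inf [:: delta; - a * t; - b * t] q *
  qhyper [:: delta / gamma; - a * t; - b * t] [:: - t * z; - t * z^-1] q gamma.
Proof.
have at1 : `|- a * t| < 1 by rewrite mulNr normrN.
have bt1 : `|- b * t| < 1 by rewrite mulNr normrN.
set a' := - a * t; set b' := - b * t; set y := - t * z; set y' := - t * z^-1.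
pose H := cauchy_prod (qbinom_coef q a' y) (qbinom_coef q b' y').
pose c0 := qpoch_inf gamma q / qpoch_inf delta q.
(* H n is (-t)^n times the Cauchy product in [qinv_ascE]; summing u over k inserts
   (delta q^n)_oo / (gamma q^n)_oo, summing it over n evaluates G(t q^k). *)
pose u n k := H n * (q ^+ n) ^+ k * qbinom_coef q gamma delta k.
have bH : geom_bounded H.
  by apply: geom_bounded_cauchy_prod; apply: geom_bounded_qbinom_coef.
have bc := geom_bounded_qbinom_coef delta hgamma1.
have [A [s [s01 A0 HA cA]]] := geom_bounded_common bH bc.
have /andP[s0 s1] := s01.
have uA n k : `|u n k| <= A * A * s ^+ n * s ^+ k.
  have weak (f : K ^nat) : (forall n, `|f n| <= A * s ^+ n * s ^+ n) ->
      forall n, `|f n| <= A * s ^+ n.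
    move=> fA m; apply: le_trans (fA m) _.
    by rewrite ler_piMr ?mulr_ge0 ?exprn_ge0 ?exprn_ile1 // ltW.
  rewrite /u !normrM mulrAC.
  have -> : A * A * s ^+ n * s ^+ k = A * s ^+ n * (A * s ^+ k) * 1 by ring.
  apply: ler_pM; rewrite ?mulr_ge0 //.
    by apply: ler_pM => //; apply: weak.
  by rewrite !normrX !exprn_ile1 // ?exprn_ge0 // ltW.
have row n : limn (series (u n)) =
    H n * (qpoch_inf (delta * q ^+ n) q / qpoch_inf (gamma * q ^+ n) q).
  have g1 : `|q ^+ n * gamma| < 1 by apply: norm_exprqM_lt1.
  rewrite ![_ * q ^+ n]mulrC -qbinomialE //.
  rewrite -limn_seriesMl //; last exact: geom_bounded_qbinom_coef.
  congr (limn (series _)); apply/funext => k.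
  by rewrite /u qbinom_coefZ mulrA.
have col k : limn (series (fun n => u n k)) =
   (qpoch_inf y q * qpoch_inf y' q) / (qpoch_inf a' q * qpoch_inf b' q) *
   qhyper_term [:: delta / gamma; a'; b'] [:: y; y'] q gamma k.
  have qk c : `|c| < 1 -> `|q ^+ k * c| < 1 by apply: norm_exprqM_lt1.
  have -> : (fun n => u n k) = fun n => qbinom_coef q gamma delta k *
     cauchy_prod (qbinom_coef q (q ^+ k * a') (q ^+ k * y))
                 (qbinom_coef q (q ^+ k * b') (q ^+ k * y')) n.
    apply/funext => n; rewrite cauchy_prod_qbinom_coefZ /u -/H -!exprM mulnC.
    by ring.
  rewrite limn_seriesMl //; last first.
    by apply: geom_bounded_cauchy_prod; apply: geom_bounded_qbinom_coef; apply: qk.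
  rewrite asc_genfun ?qk // ![q ^+ k * _]mulrC.
  rewrite (qpoch_infD y k) (qpoch_infD y' k) (qpoch_infD a' k) (qpoch_infD b' k).
  rewrite /qhyper_term /qpochs !big_cons !big_nil !mulr1 /=.
  have := qbinom_coef_qpoch hq delta k hgamma0 => e.
  have y0 := qpoch_neq0 k htz q0; have y'0 := qpoch_neq0 k htzV q0.
  have := qpoch_inf_neq0_small at1; have := qpoch_inf_neq0_small bt1.
  rewrite (qpoch_infD _ k) (qpoch_infD (- a * t) k) !mulf_eq0 !negb_or.
  rewrite -/a' -/b' => /andP[b0 bi0] /andP[a0 ai0].
  have qq0 := qpochqq_neq0 hq k.
  have -> : qbinom_coef q gamma delta k =
     gamma ^+ k * qpoch (delta / gamma) q k / qpoch q q k.
    by rewrite -e mulrC mulKf.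
  rewrite -/y -/y' in y0 y'0 *.
  field.
  by rewrite y0 y'0 b0 bi0 a0 ai0 qq0.
have d0 := qpoch_inf_neq0 hdelta.
have -> : (fun n : nat =>
      q ^+ 'C(n, 2) * t ^+ n * qpoch gamma q n / qpochs [:: q; delta] q n *
      qinv_asc q n x a b) = (fun n => c0 * limn (series (u n))).
  apply/funext => n; rewrite row (qinv_ascE q0 hq n a b hz hx).
  rewrite /H.
  have -> : a' = - t * a by rewrite /a'; ring.
  have -> : b' = - t * b by rewrite /b'; ring.
  rewrite cauchy_prod_qbinom_coefZ.
  have g1 : `|gamma * q ^+ n| < 1 by rewrite mulrC norm_exprqM_lt1.
  move: d0; rewrite /c0 (qpoch_infD gamma n) (qpoch_infD delta n).
  rewrite mulf_eq0 negb_or => /andP[dn di].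
  have gi := qpoch_inf_neq0_small g1.
  rewrite /qpochs !big_cons big_nil mulr1 (exprNn t).
  have qq0 := qpochqq_neq0 hq n.
  have qC := expf_neq0 'C(n, 2) q0.
  set X := cauchy_prod _ _ n.
  by field; rewrite dn di gi qq0 qC.
rewrite (_ : series _ = fun N => c0 * series (fun n => limn (series (u n))) N);
  last by apply/funext => N; rewrite seriesMl.
rewrite /qhyper.
have -> : qpochs_inf [:: gamma; y; y'] q / qpochs_inf [:: delta; a'; b'] q *
   limn (series (qhyper_term [:: delta / gamma; a'; b'] [:: y; y'] q gamma)) =
   c0 * limn (series (fun k => limn (series (fun n => u n k)))).
  set G := _ / _ in col.
  have G0 : G != 0.
    rewrite /G !(mulf_eq0, invr_eq0) !negb_or (qpoch_inf_neq0 htz).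
    by rewrite (qpoch_inf_neq0 htzV) !qpoch_inf_neq0_small.
  (* The 3phi2 is read off from the column sums, so its terms inherit their
     geometric bound. *)
  have bL : geom_bounded (fun k => limn (series (fun n => u n k))).
    exists (A * A / (1 - s)), s; split=> // k; rewrite mulrAC.
    by apply: (limn_series_le cK s01) => n; rewrite mulrAC.
  have -> : qhyper_term [:: delta / gamma; a'; b'] [:: y; y'] q gamma =
      fun k => G^-1 * limn (series (fun n => u n k)).
    by apply/funext => k; rewrite col mulKf.
  rewrite limn_seriesMl // -[in RHS](mulVKf G0 (limn _)) [in RHS]mulrA.
  congr (_ * _); rewrite /qpochs_inf !big_cons !big_nil !mulr1 /c0 /G !invfM.
  by ring.
by apply: cvgMr; have Fu := fubini_geom cK s01 uA; exact: Fu.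
Qed.

End QSeriesTheory.

Unset Implicit Arguments.

Theorem theorem6p26 (R : realType) (q z x a b t delta gamma : R[i])
    (hq0 : 0 < `|q|) (hq1 : `|q| < 1)
    (hz : z != 0) (hx : x = (z + z^-1) / 2)
    (hgamma0 : gamma != 0) (hgamma1 : `|gamma| < 1)
    (hat : `|a * t| < 1) (hbt : `|b * t| < 1)
    (hdelta : forall k : nat, delta != q ^- k)
    (htz : forall k : nat, - t * z != q ^- k)
    (htzV : forall k : nat, - t * z^-1 != q ^- k) :
  series (fun n : nat =>
      q ^+ 'C(n, 2) * t ^+ n * qpoch gamma q n / qpochs [:: q; delta] q n *
      qinv_asc q n x a b) @ \oo -->
  qpochs_inf [:: gamma; - t * z; - t * z^-1] q /
  qpochs_inf [:: delta; - a * t; - b * t] q *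
  qhyper [:: delta / gamma; - a * t; - b * t] [:: - t * z; - t * z^-1] q gamma.
Proof.
exact: (qinv_asc_genfun (@complex_geom_complete R) hq0 hq1 hz hx hgamma0
  hgamma1 hat hbt hdelta htz htzV).
Qed.
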